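(* Every Adinkra, interpreted as the quotient $\mathbf{F}_2^N/L$ with $L\subseteq\mathbf{F}_2^N$ a doubly even binary linear code, is invariant under a Moufang loop factor, i.e. a Moufang loop $\mathcal{L}$ quotiented by a finite group $Z$, where $Z$ and $\mathcal{L}$ satisfy the exact sequence $$1\to Z\to\mathcal{L}\to L\to 1,$$ with $L$ the doubly even binary code, $\mathcal{L}$ a Moufang loop (the code loop of $L$), and $Z$ a normal subgroup of $\mathcal{L}$, central of order $2$. Here invariance means that the Adinkra is the quotient of $\mathbf{F}_2^N$ by the factor loop $\mathcal{L}/Z\cong L$.
   Context: A binary linear code $L\subseteq\mathbf{F}_2^N$ is doubly even if the weight (number of coordinates equal to $1$) of every code word is divisible by $4$. An Adinkra is a finite graph without loops or parallel edges which is $N$-regular and bipartite (white and black vertices), with edges colored by $\{1,\dots,N\}$ so that each vertex meets exactly one edge of each color and, for any two distinct colors, the edges with these colors form a disjoint union of $4$-cycles; equipped with a dashing $d:E\to\mathbf{F}_2$ such that each $2$-colored $4$-cycle has an odd number of dashed edges; and with a ranking $h:V\to\mathbf{Z}$ for which white vertices have even rank and black vertices odd rank. By a known classification result, which the paper takes as given, every Adinkra is obtained as a quotient $\mathbf{F}_2^N/L$ with $L$ a doubly even binary linear code (the vertices of $\mathbf{F}_2^N$ being those of the $N$-cube, and $L$ acting on them by translation). A loop is a quasigroup with two-sided identity; a Moufang loop is a loop satisfying the Moufang identities, e.g. $x(y(xz))=((xy)x)z$. A code loop of $L$ is a Moufang loop $\mathcal{L}$ with a central subgroup $Z$ of order $2$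 such that $\mathcal{L}/Z\cong L$ as an elementary abelian $2$-group, whose squaring, commutator and associator maps are compatible with the code in the standard sense of code loops: with $Z$ identified with $\{\pm1\}$ and $x,y,z\in\mathcal{L}$ lying over $u,v,w\in L$, the square of $x$ is $(-1)^{|u|/4}$, the commutator of $x,y$ is $(-1)^{|u\cap v|/2}$, and the associator of $x,y,z$ is $(-1)^{|u\cap v\cap w|}$, where code words are identified with their supports. It is a known result that a code loop of a doubly even code exists and is unique up to isomorphism. The factor loop $\mathcal{L}/Z$ acts on $\mathbf{F}_2^N$ through the isomorphism $\mathcal{L}/Z\cong L$ and translations by elements of $L$.
   Formalization: That every Adinkra is a quotient of F_2^N by a doubly even code L is asserted only for nonempty connected Adinkras: as defined, an Adinkra may be disconnected (e.g. two disjoint N-cubes), and then it is no such quotient. The code-loop part holds for every Adinkra presented as F_2^N/L. *)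

(* Defs.v *)
From HB Require Import structures.
From mathcomp Require Import all_boot all_order all_algebra.

Set Implicit Arguments.
Unset Strict Implicit.
Unset Printing Implicit Defensive.

Import GRing.Theory.
Local Open Scope ring_scope.

Section Codes.

Variable N : nat.
Implicit Types (u v : 'rV['F_2]_N) (L : {vspace 'rV['F_2]_N}).

Definition supp u : {set 'I_N} := [set i | u 0 i != 0].

Definition doubly_even L : Prop := forall u, u \in L -> (4 %| #|supp u|)%N.

End Codes.

Section Adinkras.

(* A finite simple graph on V whose edges are coloured by 'I_N is encoded by
   one symmetric function col: col x y = Some i when x and y are joined by an
   edge of colour i, and col x y = None when they are not adjacent. *)

Definition bicolored N (V : finType) (col : V -> V -> option 'I_N)
    (i j : 'I_N) : rel V :=
  fun x y => col x y \in [:: Some i; Some j].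

(* The vertices of c, read cyclically, carry a 4-cycle which is a whole
   connected component of the graph r. *)
Definition four_cycle (V : finType) (r : rel V) (c : seq V) : Prop :=
  [/\ size c = 4%N, uniq c
    & forall x y, x \in c -> r x y = (y \in [:: next c x; prev c x])].

Record adinkra_axioms N (V : finType) (col : V -> V -> option 'I_N)
    (white : pred V) (dash : V -> V -> 'F_2) (rank : V -> int) : Prop := {
  ax_sym : forall x y, col x y = col y x;
  ax_loopless : forall x, col x x = None;
  ax_regular : forall x, #|[set y | col x y]| = N;
  ax_one_edge_per_color : forall x i, #|[set y | col x y == Some i]| = 1%N;
  ax_bipartite : forall x y, col x y -> white x != white y;
  ax_four_cycles : forall i j x, i != j ->
    exists2 c, four_cycle (bicolored col i j) c & x \in c;
  ax_dash_sym : forall x y, col x y -> dash x y = dash y x;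
  ax_dash_odd : forall i j c, i != j -> four_cycle (bicolored col i j) c ->
    \sum_(x <- c) dash x (next c x) = 1;
  ax_rank : forall x, white x = (2 %| rank x)%Z
}.

(* dash is only meaningful on pairs of adjacent vertices. *)
Record adinkra N (V : finType) := Adinkra {
  color : V -> V -> option 'I_N;
  white : pred V;
  dash : V -> V -> 'F_2;
  rank : V -> int;
  adinkraP : adinkra_axioms color white dash rank
}.

Definition edge N (V : finType) (A : adinkra N V) : rel V :=
  fun x y => color A x y.

Definition adinkra_connected N (V : finType) (A : adinkra N V) : Prop :=
  (0 < #|V|)%N /\ forall x y, connect (edge A) x y.

Record adinkra_hom N (V W : finType) (A : adinkra N V) (B : adinkra N W)
    (p : V -> W) : Prop := {
  hom_color : forall x y, edge A x y -> color B (p x) (p y) = color A x y;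
  hom_white : forall x, white B (p x) = white A x;
  hom_dash : forall x y, edge A x y -> dash B (p x) (p y) = dash A x y;
  hom_rank : forall x, rank B (p x) = rank A x
}.

Definition adinkra_aut N (V : finType) (A : adinkra N V) (p : V -> V) : Prop :=
  bijective p /\ adinkra_hom A A p.

Definition cube_color N (x y : 'rV['F_2]_N) : option 'I_N :=
  [pick i | y == x + delta_mx 0 i].

(* A is the quotient of the N-cube by the maps act q: for some dashing and
   ranking of the cube which make it an Adinkra C invariant under every act q,
   A is (up to isomorphism) the orbit Adinkra of C, p being the projection. *)
Record quotient_data N (V : finType) (A : adinkra N V) (Q : Type)
    (act : Q -> 'rV['F_2]_N -> 'rV['F_2]_N)
    (C : adinkra N 'rV['F_2]_N) (p : 'rV['F_2]_N -> V) : Prop := {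
  quo_cube : forall x y, color C x y = cube_color x y;
  quo_invariant : forall q, adinkra_aut C (act q);
  quo_hom : adinkra_hom C A p;
  quo_surj : forall a, exists x, p x = a;
  quo_edge_surj : forall a b, edge A a b ->
    exists x y, [/\ edge C x y, p x = a & p y = b];
  quo_fibers : forall x y, p x = p y <-> exists q, y = act q x
}.

Definition is_cube_quotient N (V : finType) (A : adinkra N V) (Q : Type)
    (act : Q -> 'rV['F_2]_N -> 'rV['F_2]_N) : Prop :=
  exists (C : adinkra N 'rV['F_2]_N) (p : 'rV['F_2]_N -> V),
    quotient_data A act C p.

Definition code_translation N (L : {vspace 'rV['F_2]_N})
    (u : subvs_of L) (x : 'rV['F_2]_N) : 'rV['F_2]_N := x + vsval u.

End Adinkras.

Local Open Scope group_scope.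

(* Loops: unital magmas with left division ldiv x y = x \ y and right division
   rdiv y x = y / x. *)
HB.mixin Record UMagma_isLoop T of UMagma T := {
  ldiv : T -> T -> T;
  rdiv : T -> T -> T;
  mulg_ldiv : forall x y : T, x * ldiv x y = y;
  ldiv_mulg : forall x y : T, ldiv x (x * y) = y;
  rdiv_mulg : forall x y : T, rdiv y x * x = y;
  mulg_rdiv : forall x y : T, rdiv (y * x) x = y
}.

HB.structure Definition CountBaseUMagma := {T of BaseUMagma T & Countable T}.

#[short(type="finLoopType")]
HB.structure Definition FinLoop := {T of UMagma_isLoop T & UMagma T & Finite T}.

Section Loops.

Variable T : finLoopType.
Implicit Types (x y z : T) (Z : {set T}).

Definition moufang : Prop := forall x y z,
  [/\ x * (y * (x * z)) = ((x * y) * x) * z,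
      y * (x * (z * x)) = ((y * x) * z) * x,
      (x * y) * (z * x) = x * ((y * z) * x)
    & (x * y) * (z * x) = (x * (y * z)) * x].

(* xy = (yx)[x,y] *)
Definition loop_commutator x y : T := ldiv (y * x) (x * y).

(* (xy)z = (x(yz))[x,y,z] *)
Definition loop_associator x y z : T := ldiv (x * (y * z)) ((x * y) * z).

Definition central Z : Prop := forall z x y, z \in Z ->
  [/\ z * x = x * z, (z * x) * y = z * (x * y),
      (x * z) * y = x * (z * y) & (x * y) * z = x * (y * z)].

Definition lcos Z x : {set T} := [set x * z | z in Z].
Definition rcos Z x : {set T} := [set z * x | z in Z].

Record normal_subloop_axioms Z : Prop := {
  ns_one : 1 \in Z;
  ns_mul : {in Z &, forall x y, x * y \in Z};
  ns_ldiv : {in Z &, forall x y, ldiv x y \in Z};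
  ns_rdiv : {in Z &, forall x y, rdiv x y \in Z};
  ns_lr : forall x, lcos Z x = rcos Z x;
  ns_l : forall x y, [set x * t | t in lcos Z y] = lcos Z (x * y);
  ns_r : forall x y, [set t * y | t in rcos Z x] = rcos Z (x * y)
}.

Record normalSubloop := NormalSubloop {
  nsset :> {set T};
  nsP : normal_subloop_axioms nsset
}.

End Loops.

Section FactorLoop.

Variables (T : finLoopType) (Z : normalSubloop T).

Definition cosets : {set {set T}} := [set lcos Z x | x in [set: T]].

Record factor := Factor { fval : {set T}; fvalP : fval \in cosets }.

HB.instance Definition _ := [isSub for fval].
HB.instance Definition _ := [Finite of factor by <:].

Definition fproj (x : T) : factor := Factor (imset_f (lcos Z) (in_setT x)).

Definition rep (A : factor) : T := odflt 1 [pick x | lcos Z x == fval A].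

Lemma repK : cancel rep fproj.
Proof.
move=> A; apply: val_inj => /=; rewrite /rep; case: pickP => [x /eqP //|noA].
by have /imsetP[x _ eqA] := fvalP A; have:= noA x; rewrite /= eqA eqxx.
Qed.

Lemma fprojE x y : (fproj x = fproj y) <-> (lcos Z x = lcos Z y).
Proof. by split=> [[] | eqxy]; last exact: val_inj. Qed.

Lemma mem_lcos x : x \in lcos Z x.
Proof. by apply/imsetP; exists 1; rewrite ?mulg1 ?(ns_one (nsP Z)). Qed.

Lemma lcosM x x' y y' : lcos Z x = lcos Z x' -> lcos Z y = lcos Z y' ->
  lcos Z (x * y) = lcos Z (x' * y').
Proof.
move=> eqx eqy; have nZ := nsP Z.
rewrite -(ns_l nZ) eqy (ns_l nZ) !(ns_lr nZ) -!(ns_r nZ).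
by rewrite -!(ns_lr nZ) eqx.
Qed.

Lemma lcosP x y : reflect (lcos Z x = lcos Z y) (x \in lcos Z y).
Proof.
have nZ := nsP Z; apply: (iffP idP) => [|<-]; last exact: mem_lcos.
case/imsetP=> z Zz ->; rewrite -(ns_l nZ).
have -> // : lcos Z z = Z.
apply/setP=> t; apply/imsetP/idP=> [[s Zs ->]|Zt]; first exact: (ns_mul nZ).
by exists (ldiv z t); rewrite ?mulg_ldiv ?(ns_ldiv nZ).
Qed.

Lemma lcos_ldiv x x' y y' : lcos Z x = lcos Z x' -> lcos Z y = lcos Z y' ->
  lcos Z (ldiv x y) = lcos Z (ldiv x' y').
Proof.
move=> eqx eqy; have nZ := nsP Z.
have: y \in lcos Z (x * ldiv x' y').
  by apply/lcosP; rewrite (lcosM eqx (erefl (lcos Z (ldiv x' y')))) mulg_ldiv.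
rewrite -(ns_l nZ) => /imsetP[t t_in ->]; rewrite ldiv_mulg.
exact/lcosP.
Qed.

Lemma lcos_rdiv x x' y y' : lcos Z x = lcos Z x' -> lcos Z y = lcos Z y' ->
  lcos Z (rdiv x y) = lcos Z (rdiv x' y').
Proof.
move=> eqx eqy; have nZ := nsP Z.
have: x \in lcos Z (rdiv x' y' * y).
  by apply/lcosP; rewrite (lcosM (erefl (lcos Z (rdiv x' y'))) eqy) rdiv_mulg.
rewrite (ns_lr nZ) -(ns_r nZ) -(ns_lr nZ) => /imsetP[t t_in ->].
rewrite mulg_rdiv; exact/lcosP.
Qed.

Definition factor_mul (A B : factor) := fproj (rep A * rep B).
Definition factor_ldiv (A B : factor) := fproj (ldiv (rep A) (rep B)).
Definition factor_rdiv (A B : factor) := fproj (rdiv (rep A) (rep B)).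

Lemma lcos_rep x : lcos Z (rep (fproj x)) = lcos Z x.
Proof. by have /fprojE := repK (fproj x). Qed.

Lemma factor_mulE x y : factor_mul (fproj x) (fproj y) = fproj (x * y).
Proof. by apply/fprojE/lcosM; rewrite lcos_rep. Qed.

Lemma factor_ldivE x y : factor_ldiv (fproj x) (fproj y) = fproj (ldiv x y).
Proof. by apply/fprojE/lcos_ldiv; rewrite lcos_rep. Qed.

Lemma factor_rdivE x y : factor_rdiv (fproj x) (fproj y) = fproj (rdiv x y).
Proof. by apply/fprojE/lcos_rdiv; rewrite lcos_rep. Qed.

Lemma factor_mul1g : left_id (fproj 1) factor_mul.
Proof. by move=> A; rewrite -(repK A) factor_mulE mul1g. Qed.

Lemma factor_mulg1 : right_id (fproj 1) factor_mul.
Proof. by move=> A; rewrite -(repK A) factor_mulE mulg1. Qed.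

HB.instance Definition _ := hasMul.Build factor factor_mul.
HB.instance Definition _ := Magma_isUMagma.Build factor factor_mul1g factor_mulg1.

Fact factor_mulg_ldiv (A B : factor) : A * factor_ldiv A B = B.
Proof.
by rewrite -(repK A) -(repK B) factor_ldivE [_ * _]factor_mulE mulg_ldiv.
Qed.

Fact factor_ldiv_mulg (A B : factor) : factor_ldiv A (A * B) = B.
Proof.
by rewrite -(repK A) -(repK B) [_ * _]factor_mulE factor_ldivE ldiv_mulg.
Qed.

Fact factor_rdiv_mulg (A B : factor) : factor_rdiv B A * A = B.
Proof.
by rewrite -(repK A) -(repK B) factor_rdivE [_ * _]factor_mulE rdiv_mulg.
Qed.

Fact factor_mulg_rdiv (A B : factor) : factor_rdiv (B * A) A = B.
Proof.
by rewrite -(repK A) -(repK B) [_ * _]factor_mulE factor_rdivE mulg_rdiv.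
Qed.

HB.instance Definition _ := UMagma_isLoop.Build factor
  factor_mulg_ldiv factor_ldiv_mulg factor_rdiv_mulg factor_mulg_rdiv.

Lemma fprojM : {morph fproj : x y / x * y}.
Proof. by move=> x y; rewrite [RHS]factor_mulE. Qed.

End FactorLoop.

Arguments fproj {T} Z x.

(* 1 -> Z -> T -> V -> 1, the first map being the inclusion. *)
Definition short_exact (T : finLoopType) (Z : {set T}) (V : zmodType)
    (pi : T -> V) : Prop :=
  [/\ {morph pi : x y / x * y >-> (x + y)%R},
      forall u, exists x, pi x = u
    & forall x, x \in Z <-> pi x = 0%R].

(* f is the isomorphism T / Z ~ L; the element of Z other than 1 plays the
   role of -1. *)
Record code_loop N (L : {vspace 'rV['F_2]_N}) (T : finLoopType)
    (Z : normalSubloop T) (f : factor Z -> subvs_of L) : Prop := {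
  cl_moufang : moufang T;
  cl_central : central Z;
  cl_order2 : #|Z| = 2%N;
  cl_bij : bijective f;
  cl_morph : {morph f : a b / a * b >-> (a + b)%R};
  cl_square : forall (m x : T), m \in Z -> m != 1 ->
    let S := supp (vsval (f (fproj Z x))) in
    x * x = m ^+ (#|S| %/ 4);
  cl_commutator : forall (m x y : T), m \in Z -> m != 1 ->
    let S := supp (vsval (f (fproj Z x))) in
    let S' := supp (vsval (f (fproj Z y))) in
    loop_commutator x y = m ^+ (#|S :&: S'| %/ 2);
  cl_associator : forall (m x y z : T), m \in Z -> m != 1 ->
    let S := supp (vsval (f (fproj Z x))) in
    let S' := supp (vsval (f (fproj Z y))) in
    let S'' := supp (vsval (f (fproj Z z))) in
    loop_associator x y z = m ^+ #|S :&: S' :&: S''|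
}.

Definition factor_translation N (L : {vspace 'rV['F_2]_N}) (T : finLoopType)
    (Z : normalSubloop T) (f : factor Z -> subvs_of L)
    (q : factor Z) (x : 'rV['F_2]_N) : 'rV['F_2]_N :=
  code_translation (f q) x.

(* Main.v *)
Require Import Defs.
From HB Require Import structures.
From mathcomp Require Import all_boot all_order all_algebra.
From mathcomp Require Import ring zify.

Set Implicit Arguments.
Unset Strict Implicit.
Unset Printing Implicit Defensive.

Import GRing.Theory.
Local Open Scope ring_scope.

(** A connected Adinkra is a coset space of the cube: by the 4-cycle axiom the
    N involutions that follow the edge of a given colour commute, so they define
    an action of the group of binary vectors on the vertices, transitive by
    connectedness.  The stabiliser L of a base vertex is a linear code, the
    orbit map identifies the vertices with the cosets of L, and pulling the
    colouring, dashing and ranking back along it makes the cube an Adinkra on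
    which L acts by automorphisms ([stabiliser_quotient]).

    That L is doubly even is a Clifford algebra computation.  On the double
    cover of the vertex set where a dashed edge changes sheet, the colour
    involutions lift to involutions which anticommute, because each 2-coloured
    square has an odd number of dashed edges; so the square of a product of k
    distinct ones is the sheet exchange to the power k(k-1)/2
    ([walk_dash_twice]).  When such a product fixes a vertex, k(k-1)/2 is
    therefore even; bipartiteness makes k itself even, and together these say
    that 4 divides k ([closed_walk_size]).

    The code loop of a doubly even code L is built on the product of L by the
    two-element field, with multiplication twisted by a function phi of two code
    words.  Over the two-element field write P(u), K(u,v), T(u,v,w) for |u|/4,
    |u /\ v|/2 and |u /\ v /\ w|.  Since |u + v| = |u| + |v| - 2|u /\ v|, each
    is the polarisation of the previous one and T is trilinear: P is a cubic
    form.  What is wanted is phi with phi(u,u) = P(u), with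
    phi(u,v) + phi(v,u) = K(u,v) and with associativity defect T.  It is built
    by adding the vectors of a basis one at a time: if b is the new vector and
    u, v are combinations of the earlier ones, then
      phi(u + x b, v + y b)
        = phi(u,v) + x y P(b) + y K(u,b) + x T(u,v,b),
    which is the form dictated by P(u + x b) = P(u) + x P(b) + x K(u,b).  The
    Moufang identities use only that T is an alternating symmetric trilinear
    form ([tw_moufang]).  Finally L acts on the cube through the factor loop,
    which is isomorphic to L, so the two quotients are the same
    ([quotient_by_factor]). *)

(** * Arithmetic modulo two *)

Lemma F2P (a : 'F_2) : a = 0 \/ a = 1.
Proof. by case: a => [[|[|n]] //= h]; [left|right]; apply: val_inj. Qed.

Lemma addF2 (a : 'F_2) : a + a = 0.
Proof. by case: (F2P a) => ->; apply: val_inj. Qed.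

Lemma oppF2 (a : 'F_2) : - a = a.
Proof. by case: (F2P a) => ->; apply: val_inj. Qed.

Lemma addF2_lmod (V : lmodType 'F_2) (x : V) : x + x = 0.
Proof. by rewrite -[x]scale1r -scalerDl addF2 scale0r. Qed.

Lemma natF2 n : (n%:R : 'F_2) = (odd n)%:R.
Proof.
elim: n => //= n IH; rewrite -natr1 IH.
by case: (odd n); apply: val_inj.
Qed.

Lemma natF2_eq0 n : (n%:R == 0 :> 'F_2) = ~~ odd n.
Proof. by rewrite natF2; case: (odd n). Qed.

(** * Coloured graphs whose colours are commuting involutions *)

Section FourSequences.

Variables (V : eqType) (a b c d : V).
Hypothesis U : uniq [:: a; b; c; d].

Lemma next_prev4 :
  [/\ next [:: a; b; c; d] a = b, next [:: a; b; c; d] b = c,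
      next [:: a; b; c; d] c = d & next [:: a; b; c; d] d = a] /\
  [/\ prev [:: a; b; c; d] a = d, prev [:: a; b; c; d] b = a,
      prev [:: a; b; c; d] c = b & prev [:: a; b; c; d] d = c].
Proof.
move: U; rewrite /= !inE !negb_or !andbT.
case/and3P => /and3P[ab ac ad] /andP[bc bd] cd.
have := (negPf ab, negPf ac, negPf ad, (negPf bc, negPf bd, negPf cd)).
move=> E.
have E' := (eq_sym b a, eq_sym c a, eq_sym d a, (eq_sym c b, eq_sym d b, eq_sym d c)).
by rewrite ?(E', E, eqxx).
Qed.

End FourSequences.

(** The map [nb i] follows the edge of colour [i].  Working with it instead of
    the colouring lets the same lemmas serve for an Adinkra and for the cube. *)
Section ColouredGraphs.

Variables (N : nat) (V : finType) (col : V -> V -> option 'I_N).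
Variable nb : 'I_N -> V -> V.
Hypothesis colP : forall x y i, col x y = Some i <-> y = nb i x.
Hypothesis col_sym : forall x y, col x y = col y x.
Hypothesis col_loopless : forall x, col x x = None.

Lemma col_nb i x : col x (nb i x) = Some i.
Proof. exact/colP. Qed.

Lemma nbK i : involutive (nb i).
Proof. by move=> x; apply/esym/colP; rewrite col_sym col_nb. Qed.

Lemma nb_neq i x : x != nb i x.
Proof. by apply/eqP => E; have := col_nb i x; rewrite -E col_loopless. Qed.

Lemma nb_inj_color i j x : nb i x = nb j x -> i = j.
Proof. by move=> E; have := col_nb i x; rewrite E col_nb => -[]. Qed.

Lemma bicoloredE i j x y :
  bicolored col i j x y = (y \in [:: nb i x; nb j x]).
Proof.
have E k : (col x y == Some k) = (y == nb k x) by apply/eqP/eqP => /colP.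
by rewrite /bicolored !inE !E.
Qed.

Lemma card_neighbours x : #|[set y | col x y]| = N.
Proof.
have -> : [set y | col x y] = [set nb i x | i in [set: 'I_N]].
  apply/setP=> y; rewrite inE; apply/idP/imsetP => [|[i _ ->]].
    by case E: (col x y) => [i|] // _; exists i; rewrite ?inE //; apply/colP.
  by rewrite col_nb.
by rewrite card_imset ?cardsT ?card_ord // => i j; apply: nb_inj_color.
Qed.

Lemma card_neighbours_color x i : #|[set y | col x y == Some i]| = 1%N.
Proof.
have -> : [set y | col x y == Some i] = [set nb i x]; last exact: cards1.
by apply/setP=> y; rewrite !inE; apply/eqP/eqP => /colP.
Qed.

Definition square i j x := [:: x; nb i x; nb j (nb i x); nb j x].

Lemma uniq_square i j x : i != j -> uniq (square i j x).
Proof.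
move=> ij; have nij y : nb i y != nb j y.
  by apply: contra ij => /eqP/nb_inj_color->.
have xij : x != nb j (nb i x).
  by rewrite eq_sym (can2_eq (nbK j) (nbK j)) nij.
rewrite /= !inE !negb_or xij nij !nb_neq /= (can_eq (nbK j)).
by rewrite eq_sym nb_neq.
Qed.

Lemma square_four_cycle i j x : i != j -> nb i (nb j x) = nb j (nb i x) ->
  four_cycle (bicolored col i j) (square i j x).
Proof.
move=> ij com; have Us := uniq_square x ij; split=> //.
have [[n1 n2 n3 n4] [p1 p2 p3 p4]] := next_prev4 Us.
move=> y z; rewrite bicoloredE !inE => /or4P[] /eqP ->.
- by rewrite n1 p1.
- by rewrite n2 p2 nbK orbC.
- by rewrite n3 p3 -{1}com !nbK orbC.
- by rewrite n4 p4 nbK com orbC.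
Qed.

(** The two neighbours of a vertex on a bicoloured 4-cycle carry the two
    colours, and since the vertex opposite to it differs from it, the colours
    alternate.  Closing up is then the commutation of the two colours. *)
Lemma four_cycle_shape i j c : i != j -> four_cycle (bicolored col i j) c ->
  exists x k l, [/\ (k = i /\ l = j) \/ (k = j /\ l = i),
    c = square k l x & nb k (nb l x) = nb l (nb k x)].
Proof.
move=> ij [szc Uc Nc].
case: c szc Uc Nc => [//|x [//|y [//|z [//|w [|//]]]]] _ Uc Nc.
have [[n1 n2 n3 n4] [p1 p2 p3 p4]] := next_prev4 Uc.
have Nx t : t \in [:: nb i x; nb j x] -> t \in [:: y; w].
  by rewrite -bicoloredE Nc ?n1 ?p1 // inE eqxx.
have Ny t : (t \in [:: z; x]) -> t \in [:: nb i y; nb j y].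
  by rewrite -bicoloredE Nc ?n2 ?p2 // !inE eqxx orbT.
have Nw t : (t \in [:: x; z]) -> t \in [:: nb i w; nb j w].
  by rewrite -bicoloredE Nc ?n4 ?p4 // !inE eqxx !orbT.
move: Uc; rewrite /= !inE !negb_or !andbT.
case/and3P => /and3P[xy xz xw] /andP[yz yw] zw.
have zNy : z \in [:: nb i y; nb j y] by apply: Ny; rewrite inE eqxx.
have zNw : z \in [:: nb i w; nb j w] by apply: Nw; rewrite !inE eqxx orbT.
have iNx := Nx (nb i x); have jNx := Nx (nb j x).
rewrite !inE !eqxx ?orbT in iNx jNx zNy zNw.
have nij : nb i x != nb j x by apply: contra ij => /eqP/nb_inj_color->.
case/orP: (iNx isT) => /eqP Ei; case/orP: (jNx isT) => /eqP Ej.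
- by rewrite Ei Ej eqxx in nij.
- have zjy : z = nb j y.
    case/orP: zNy => /eqP // E; by rewrite E -Ei nbK eqxx in xz.
  have ziw : z = nb i w.
    case/orP: zNw => /eqP // E; by rewrite E -Ej nbK eqxx in xz.
  exists x, i, j; rewrite /square Ei Ej -zjy -ziw; split=> //; by left.
- have zjy : z = nb i y.
    case/orP: zNy => /eqP // E; by rewrite E -Ej nbK eqxx in xz.
  have ziw : z = nb j w.
    case/orP: zNw => /eqP // E; by rewrite E -Ei nbK eqxx in xz.
  exists x, j, i; rewrite /square Ei Ej -zjy -ziw; split=> //; by right.
- by rewrite Ei Ej eqxx in nij.
Qed.

Lemma sum_square (d : V -> V -> 'F_2) i j x : i != j ->
  \sum_(y <- square i j x) d y (next (square i j x) y) =
  d x (nb i x) + d (nb i x) (nb j (nb i x))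
  + d (nb j (nb i x)) (nb j x) + d (nb j x) x.
Proof.
move=> ij; have [[n1 n2 n3 n4] _] := next_prev4 (uniq_square x ij).
by rewrite !big_cons big_nil n1 n2 n3 n4 addr0 !addrA.
Qed.

(** A given vertex may sit anywhere on its 4-cycle, while the shape of the cycle
    yields commutation at one corner; involutivity carries it to the others. *)
Lemma nb_comm_square i j x : nb i (nb j x) = nb j (nb i x) ->
  {in square i j x, forall y, nb i (nb j y) = nb j (nb i y)}.
Proof.
move=> com y; rewrite !inE => /or4P[] /eqP -> //.
- by rewrite nbK -com nbK.
- by rewrite -com !nbK com !nbK.
- by rewrite com !nbK.
Qed.

Lemma nb_comm i j x :
    (exists2 c, four_cycle (bicolored col i j) c & x \in c) ->
  i != j -> nb i (nb j x) = nb j (nb i x).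
Proof.
case=> c cc xc ij; have [y [k [l [kl Dc com]]]] := four_cycle_shape ij cc.
rewrite Dc in xc; have := nb_comm_square com xc.
by case: kl => -[-> ->].
Qed.

End ColouredGraphs.

(** * Dashings along walks in an Adinkra *)

Section Walks.

Variables (N : nat) (V : finType) (A : adinkra N V).

Let AP := adinkraP A.

(** The default value is never taken: there is exactly one edge of each
    colour at each vertex. *)
Definition neighbour (i : 'I_N) (x : V) : V :=
  odflt x [pick y | color A x y == Some i].

Lemma colorP x y i : color A x y = Some i <-> y = neighbour i x.
Proof.
have /eqP/cards1P[z Dz] := ax_one_edge_per_color AP x i.
have colE t : (color A x t == Some i) = (t == z).
  by have /setP/(_ t) := Dz; rewrite !inE.
have -> : neighbour i x = z.
  rewrite /neighbour; case: pickP => [t|/(_ z)]; first by rewrite colE => /eqP.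
  by rewrite colE eqxx.
by split=> [/eqP|->]; [rewrite colE => /eqP | apply/eqP; rewrite colE].
Qed.

Let csym := ax_sym AP.
Let cloop := ax_loopless AP.

Lemma neighbourK i : involutive (neighbour i).
Proof. exact: nbK colorP csym i. Qed.

Lemma neighbourC i j x :
  neighbour i (neighbour j x) = neighbour j (neighbour i x).
Proof.
case: (eqVneq i j) => [->//|ij].
exact: (nb_comm colorP csym (ax_four_cycles AP x ij) ij).
Qed.

Lemma edge_neighbour i x : edge A x (neighbour i x).
Proof. by rewrite /edge (col_nb colorP). Qed.

Lemma edgeP x y : edge A x y -> exists i, y = neighbour i x.
Proof.
by rewrite /edge; case E: (color A x y) => [i|] // _; exists i; apply/colorP.
Qed.

Lemma dash_square i j x : i != j ->
  dash A x (neighbour i x) + dash A (neighbour i x) (neighbour j (neighbour i x))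
  + dash A (neighbour j (neighbour i x)) (neighbour j x)
  + dash A (neighbour j x) x = 1.
Proof.
move=> ij; rewrite -(sum_square colorP csym cloop) //.
apply: (ax_dash_odd AP ij).
by apply: (square_four_cycle colorP csym cloop ij); apply: neighbourC.
Qed.

(** Like a product of operators, a walk reads its colours from right to left. *)
Fixpoint walk (s : seq 'I_N) (v : V) : V :=
  if s is i :: s' then neighbour i (walk s' v) else v.

(** The parity of the number of dashed edges, that is, the change of sheet along
    the walk in the double cover defined by the dashing. *)
Fixpoint walk_dash (s : seq 'I_N) (v : V) : 'F_2 :=
  if s is i :: s' then
    walk_dash s' v + dash A (walk s' v) (neighbour i (walk s' v))
  else 0.

Lemma walk_neighbour s i v : walk s (neighbour i v) = neighbour i (walk s v).
Proof. by elim: s => //= j s ->; rewrite neighbourC. Qed.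

Lemma walkK s : involutive (walk s).
Proof. by elim: s => //= i s IH v; rewrite walk_neighbour neighbourK IH. Qed.

Lemma dash_sym i x : dash A (neighbour i x) x = dash A x (neighbour i x).
Proof. by apply/esym/(ax_dash_sym AP)/edge_neighbour. Qed.

(** The lift of colour [i] anticommutes with each of the lifted steps of the
    walk: the strip between the walk and its translate by [i] consists of one
    square per step, each contributing 1. *)
Lemma walk_dash_neighbour s i v : i \notin s ->
  walk_dash s (neighbour i v) =
  walk_dash s v + dash A v (neighbour i v)
  + dash A (walk s v) (neighbour i (walk s v)) + (size s)%:R.
Proof.
elim: s => [_|j s IH] /=; first by rewrite add0r addr0 addF2.
rewrite inE negb_or eq_sym => /andP[ji is_]; rewrite IH // walk_neighbour.
set w := walk s v; have := dash_square w ji.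
rewrite dash_sym -{2}neighbourC dash_sym neighbourC.
set p := dash A w _; set q := dash A _ (neighbour i _).
set r := dash A (neighbour i w) _; set m := dash A (neighbour j w) _ => E.
(* The square contributes the 1 of the successor; the pair p + m occurs twice. *)
rewrite -natr1 -E -[LHS]addr0 -(addF2 (p + m)); ring.
Qed.

(** In the square of a product of k anticommuting involutions, moving the
    factors of one copy next to their twins exchanges k(k-1)/2 pairs. *)
Lemma walk_dash_twice s v : uniq s ->
  walk_dash s (walk s v) + walk_dash s v = 'C(size s, 2)%:R.
Proof.
elim: s => [_|i s IH] /=; first by rewrite addr0.
case/andP=> is_ Us; rewrite walk_neighbour walkK walk_dash_neighbour //.
rewrite walkK neighbourK dash_sym binS bin1 natrD -IH //.
set p := dash A v _; set q := dash A (walk s v) _.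
rewrite -[RHS]addr0 -(addF2 (p + q)); ring.
Qed.

Lemma white_neighbour i x : white A (neighbour i x) = ~~ white A x.
Proof.
have := ax_bipartite AP (edge_neighbour i x).
by case: (white A x); case: (white A _).
Qed.

Lemma white_walk s v : white A (walk s v) = white A v (+) odd (size s).
Proof.
elim: s => [|i s IH] /=; first by rewrite addbF.
by rewrite white_neighbour IH addbN.
Qed.

(** Bipartiteness gives an even size 2m; walking twice around gives total
    dashing zero, so the binomial coefficient m(2m-1) is even, hence so is m. *)
Lemma closed_walk_size s v : uniq s -> walk s v = v -> (4 %| size s)%N.
Proof.
move=> Us sv; have := walk_dash_twice v Us; have := white_walk s v.
rewrite sv addF2; case: odd (odd_double_half (size s)) => [|<- _].
  by case: (white A v).
rewrite add0n bin2 -doubleMl doubleK => /esym/eqP; rewrite natF2_eq0 oddM.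
case: (_./2) => // m; rewrite doubleS /= odd_double andbT negbK => om.
by lia.
Qed.

End Walks.

(** * The cube as a cover of an Adinkra *)

Section Cube.

Variable N : nat.
Implicit Types x y u : 'rV['F_2]_N.

Definition flip (i : 'I_N) x := x + delta_mx 0 i.

Lemma cube_colorP x y i : cube_color x y = Some i <-> y = flip i x.
Proof.
rewrite /cube_color; case: pickP => [j /eqP ->|none]; last first.
  by split=> // E; have := none i; rewrite E eqxx.
split=> [[->] //|/addrI/matrixP/(_ 0 j)]; rewrite !mxE !eqxx /=.
by case: eqP => [->|].
Qed.

Lemma cube_color_add x y u : cube_color (x + u) (y + u) = cube_color x y.
Proof.
by apply: eq_pick => i; rewrite addrAC (inj_eq (addIr _)).
Qed.

Lemma cube_color_sym x y : cube_color x y = cube_color y x.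
Proof.
apply: eq_pick => i; rewrite -[RHS]subr_eq [RHS]eq_sym; congr (_ == x + _).
by apply/matrixP=> k l; rewrite !mxE oppF2.
Qed.

Lemma cube_color_loopless x : cube_color x x = None.
Proof.
case E: (cube_color x x) => [i|] //; move/cube_colorP: E.
rewrite -[LHS]addr0 => /addrI/matrixP/(_ 0 i); rewrite !mxE !eqxx /=.
by move/eqP; rewrite eq_sym oner_eq0.
Qed.

Lemma flipC i j x : flip i (flip j x) = flip j (flip i x).
Proof. exact: addrAC. Qed.

End Cube.

Section CubeCover.

Variables (N : nat) (V : finType) (A : adinkra N V) (p : 'rV['F_2]_N -> V).
Hypothesis p_flip : forall i x, p (flip i x) = neighbour A i (p x).

(** A map commuting with all the colour involutions is a local isomorphism of
    coloured graphs, so all the structure of an Adinkra pulls back along it. *)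
Lemma cover_axioms : adinkra_axioms (@cube_color N) (fun x => white A (p x))
  (fun x y => dash A (p x) (p y)) (fun x => rank A (p x)).
Proof.
have AP := adinkraP A.
have colP := @cube_colorP N.
have csym := @cube_color_sym N; have cloop := @cube_color_loopless N.
have p_edge x y : cube_color x y -> edge A (p x) (p y).
  case E: (cube_color x y) => [i|] // _; move/colP: E => ->.
  by rewrite p_flip edge_neighbour.
split=> //.
- exact: card_neighbours colP.
- exact: card_neighbours_color colP.
- by move=> x y /p_edge; apply: (ax_bipartite AP).
- move=> i j x ij; exists (square (@flip N) i j x); last exact: mem_head.
  by apply: (square_four_cycle colP csym cloop ij); apply: flipC.
- by move=> x y /p_edge; apply: (ax_dash_sym AP).
- move=> i j c ij cc.
  have [x [k [l [kl -> _]]]] := four_cycle_shape colP csym ij cc.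
  have lk : k != l by case: kl => -[-> ->] //; rewrite eq_sym.
  rewrite (sum_square colP csym cloop (fun x y => dash A (p x) (p y))) //.
  by rewrite !p_flip dash_square.
- by move=> x; apply: (ax_rank AP).
Qed.

Definition cover := Adinkra cover_axioms.

Variable L : {vspace 'rV['F_2]_N}.
Hypothesis p_surj : forall a, exists x, p x = a.
Hypothesis p_fibers : forall x y, p x = p y <-> x + y \in L.

Lemma p_translate x u : u \in L -> p (x + u) = p x.
Proof. by move=> Lu; apply/p_fibers; rewrite addrAC addF2_lmod add0r. Qed.

Lemma cover_quotient : is_cube_quotient A (@code_translation N L).
Proof.
exists cover, p; split=> //.
- move=> q; split.
    by exists (fun x => x - vsval q) => x; rewrite /code_translation ?addrK ?subrK.
  have pq x : p (code_translation q x) = p x by apply: p_translate; apply: subvsP.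
  by split=> /= [x y _|x|x y _|x]; rewrite ?pq ?cube_color_add.
- split=> //= x y; rewrite /edge /=.
  case E: (cube_color x y) => [i|] // _; move/cube_colorP: E => ->.
  by rewrite p_flip (col_nb (@colorP _ _ A)).
- move=> a b /edgeP[i ->]; have [x <-] := p_surj a.
  exists x, (flip i x); split=> //.
  by rewrite /edge /= (col_nb (@cube_colorP N)).
- move=> x y; rewrite p_fibers; split=> [Lxy|[q ->]].
    exists (Subvs Lxy); rewrite /code_translation /= addrA addF2_lmod.
    by rewrite add0r.
  by rewrite /code_translation addrA addF2_lmod add0r subvsP.
Qed.

End CubeCover.

(** * The code of a connected Adinkra *)

Section ConnectedAdinkra.

Variables (N : nat) (V : finType) (A : adinkra N V).
Implicit Types (u w : 'rV['F_2]_N) (v : V).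

(** The group of binary vectors acts by walking once along each colour of the
    support; the order is immaterial because colours commute. *)
Definition support_seq u := [seq i <- enum 'I_N | u 0 i != 0].
Definition cube_act u v := walk A (support_seq u) v.

Lemma size_support_seq u : size (support_seq u) = #|supp u|.
Proof.
have Us : uniq (support_seq u) by rewrite filter_uniq ?enum_uniq.
rewrite -(card_uniqP Us).
apply: eq_card => i; by rewrite mem_filter mem_enum !inE andbT.
Qed.

Lemma cube_actD u w v : cube_act (u + w) v = cube_act u (cube_act w v).
Proof.
rewrite /cube_act /support_seq; elim: (enum _) => //= i s IH; rewrite mxE.
case: (F2P (u 0 i)) => ->; case: (F2P (w 0 i)) => -> /=; rewrite IH //.
- by rewrite walk_neighbour.
- by rewrite walk_neighbour neighbourK.
Qed.

Lemma cube_act_delta i v : cube_act (delta_mx 0 i) v = neighbour A i v.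
Proof.
rewrite /cube_act /support_seq (_ : filter _ _ = [:: i]) //.
rewrite (@eq_filter _ _ (pred1 i)) ?filter_pred1_uniq ?enum_uniq ?mem_enum //.
by move=> j; rewrite mxE eqxx /=; case: (j == i).
Qed.

Lemma cube_act0 v : cube_act 0 v = v.
Proof.
rewrite /cube_act /support_seq (_ : filter _ _ = [::]) //.
by rewrite (@eq_filter _ _ pred0) ?filter_pred0 // => i; rewrite /= mxE eqxx.
Qed.

Lemma cube_act_transitive v a :
  connect (edge A) v a -> exists u, cube_act u v = a.
Proof.
case/connectP=> q; elim: q v => [|x q IH] v /= => [_ ->|].
  by exists 0; rewrite cube_act0.
case/andP=> /edgeP[i ->] qP /(IH _ qP)[u <-].
by exists (u + delta_mx 0 i); rewrite cube_actD cube_act_delta.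
Qed.

Variable v0 : V.

(** The span adds nothing to the set, which is already closed under addition;
    it only provides the type of a subspace. *)
Definition stabiliser : {vspace 'rV['F_2]_N} :=
  <<enum [set u | cube_act u v0 == v0]>>%VS.

Lemma mem_stabiliser u : (u \in stabiliser) = (cube_act u v0 == v0).
Proof.
apply/idP/eqP => [|uv0]; last by apply: memv_span; rewrite mem_enum inE uv0.
move=> /coord_span ->; elim/big_ind: _ => [|x y Ex Ey|i _].
- exact: cube_act0.
- by rewrite cube_actD Ey.
move: (coord _ i u) => a; case: (F2P a) => ->; first by rewrite scale0r cube_act0.
rewrite scale1r; apply/eqP.
have ltX : (i < size (enum [set w | cube_act w v0 == v0]))%N by rewrite -cardE.
by have := mem_nth 0 ltX; rewrite mem_enum inE.
Qed.

Lemma stabiliser_doubly_even : doubly_even stabiliser.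
Proof.
move=> u; rewrite mem_stabiliser -size_support_seq => /eqP.
by apply: closed_walk_size; rewrite filter_uniq ?enum_uniq.
Qed.

Lemma stabiliser_quotient : (forall a, connect (edge A) v0 a) ->
  is_cube_quotient A (@code_translation N stabiliser).
Proof.
move=> con; apply: (@cover_quotient _ _ A (fun u => cube_act u v0)).
- by move=> i x; rewrite /flip addrC cube_actD cube_act_delta.
- by move=> a; apply: cube_act_transitive.
- move=> x y; rewrite mem_stabiliser cube_actD; split=> [E|/eqP E].
    by rewrite -E -cube_actD addF2_lmod cube_act0.
  by rewrite -{1}E -cube_actD addF2_lmod cube_act0.
Qed.

End ConnectedAdinkra.

(** * The cubic form of a doubly even code *)

Section Weights.

Variable N : nat.
Implicit Types (u v w : 'rV['F_2]_N) (S : {set 'I_N}).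

(** The inclusion-exclusion identity behind all polarisation formulas. *)
Lemma card_supp_add u v S :
  (#|supp (u + v) :&: S| + 2 * #|supp u :&: supp v :&: S|
   = #|supp u :&: S| + #|supp v :&: S|)%N.
Proof.
have cardE (A : {set 'I_N}) : #|A| = (\sum_i (i \in A))%N.
  by rewrite -sum1_card big_mkcond; apply: eq_bigr => i _; case: (i \in A).
rewrite !cardE big_distrr -!big_split; apply: eq_bigr => i _ /=.
rewrite !inE mxE.
by case: (F2P (u 0 i)) => ->; case: (F2P (v 0 i)) => ->; case: (i \in S).
Qed.

(** The cubic form of the code and its successive polarisations; the truncated
    divisions are exact on doubly even codes. *)
Definition quarter u : 'F_2 := (#|supp u| %/ 4)%:R.
Definition half u v : 'F_2 := (#|supp u :&: supp v| %/ 2)%:R.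
Definition triple u v w : 'F_2 := #|supp u :&: supp v :&: supp w|%:R.

Lemma tripleE u v w : triple u v w = \sum_i u 0 i * v 0 i * w 0 i.
Proof.
rewrite /triple -sum1_card natr_sum big_mkcond /=; apply: eq_bigr => i _.
rewrite !inE; case: (F2P (u 0 i)) => ->; case: (F2P (v 0 i)) => ->;
by case: (F2P (w 0 i)) => ->; apply: val_inj.
Qed.

Lemma tripleC u v w : triple u v w = triple v u w.
Proof. by rewrite /triple (setIC (supp u)). Qed.

Lemma tripleAC u v w : triple u v w = triple u w v.
Proof. by rewrite /triple setIAC. Qed.

Lemma tripleDl u v w t : triple (u + v) w t = triple u w t + triple v w t.
Proof.
rewrite !tripleE -big_split; apply: eq_bigr => i _ /=.
by rewrite mxE !mulrDl.
Qed.

Lemma tripleDm u v w t : triple w (u + v) t = triple w u t + triple w v t.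
Proof. by rewrite tripleC tripleDl !(tripleC _ w). Qed.

Lemma tripleDr u v w t : triple w t (u + v) = triple w t u + triple w t v.
Proof. by rewrite tripleAC tripleDm !(tripleAC w t). Qed.

Lemma tripleZl a u v w : triple (a *: u) v w = a * triple u v w.
Proof.
by rewrite !tripleE big_distrr; apply: eq_bigr => i _ /=; rewrite mxE !mulrA.
Qed.

Lemma tripleZm a u v w : triple v (a *: u) w = a * triple v u w.
Proof. by rewrite tripleC tripleZl tripleC. Qed.

Lemma tripleZr a u v w : triple v w (a *: u) = a * triple v w u.
Proof. by rewrite tripleAC tripleZm tripleAC. Qed.

Lemma supp0 : supp (0 : 'rV['F_2]_N) = set0.
Proof. by apply/setP=> i; rewrite !inE mxE eqxx. Qed.

Lemma triple0 u v : triple 0 u v = 0.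
Proof. by rewrite /triple supp0 !set0I cards0. Qed.

Lemma half0 u : half 0 u = 0.
Proof. by rewrite /half supp0 !set0I cards0. Qed.

Lemma quarter0 : quarter 0 = 0.
Proof. by rewrite /quarter supp0 cards0. Qed.

Lemma halfC u v : half u v = half v u.
Proof. by rewrite /half setIC. Qed.

Variable L : {vspace 'rV['F_2]_N}.
Hypothesis L_even : doubly_even L.

Lemma meet_even u v : u \in L -> v \in L -> (2 %| #|supp u :&: supp v|)%N.
Proof.
move=> Lu Lv; have := card_supp_add u v setT; rewrite !setIT.
move: (L_even Lu) (L_even Lv) (L_even (memvD Lu Lv)).
move: #|supp u| #|supp v| #|supp (u + v)| #|supp u :&: _|.
by lia.
Qed.

Lemma triple_diag u v : u \in L -> v \in L -> triple u u v = 0.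
Proof.
move=> Lu Lv; apply/eqP.
by rewrite /triple setIid natF2_eq0 -dvdn2 meet_even.
Qed.

Lemma half_diag u : u \in L -> half u u = 0.
Proof.
move=> Lu; have := L_even Lu; rewrite /half setIid => Hu; apply/eqP.
by rewrite natF2_eq0; lia.
Qed.

Lemma quarterD u v : u \in L -> v \in L ->
  quarter (u + v) = quarter u + quarter v + half u v.
Proof.
move=> Lu Lv; have := card_supp_add u v setT; rewrite !setIT.
move: (L_even Lu) (L_even Lv) (L_even (memvD Lu Lv)) => d1 d2 d3 E.
rewrite /quarter /half -!natrD natF2 [RHS]natF2; congr (nat_of_bool _)%:R.
move: #|supp u| #|supp v| #|supp (u + v)| #|supp u :&: _| d1 d2 d3 E.
by lia.
Qed.

Lemma halfDl u v w : u \in L -> v \in L -> w \in L ->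
  half (u + v) w = half u w + half v w + triple u v w.
Proof.
move=> Lu Lv Lw; have := card_supp_add u v (supp w).
move: (meet_even Lu Lw) (meet_even Lv Lw) (meet_even (memvD Lu Lv) Lw).
move=> d1 d2 d3 E.
rewrite /half /triple -!natrD natF2 [RHS]natF2; congr (nat_of_bool _)%:R.
move: #|supp u :&: supp w| #|supp v :&: _| #|supp (u + v) :&: _|
  #|supp u :&: _ :&: _| d1 d2 d3 E.
by lia.
Qed.

Lemma halfDr u v w : u \in L -> v \in L -> w \in L ->
  half w (u + v) = half w u + half w v + triple w u v.
Proof.
by move=> Lu Lv Lw; rewrite halfC halfDl // !(halfC w) (tripleC w) (tripleAC u w).
Qed.

End Weights.

(** * A cochain inducing the cubic form *)

Section Cocycle.

Variables (N : nat) (b : nat -> 'rV['F_2]_N).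
Implicit Types (x y z : nat -> 'F_2).

(** Coordinates are functions on all of [nat], so that truncating them at [n]
    needs no change of type in the inductions on [n]. *)
Definition comb n x : 'rV['F_2]_N := \sum_(i < n) x i *: b i.

(** The cochain obtained by adding the vectors [b j] one at a time; the [j]-th
    term is the correction x_j y_j P(b_j) + y_j K(u,b_j) + x_j T(u,v,b_j), where
    u and v are the combinations of the earlier vectors. *)
Definition cocycle n x y : 'F_2 := \sum_(j < n)
  (x j * y j * quarter (b j) + y j * half (comb j x) (b j)
   + x j * triple (comb j x) (comb j y) (b j)).

Lemma comb0 n x : x =1 (fun=> 0) -> comb n x = 0.
Proof. by move=> x0; apply: big1 => i _; rewrite x0 scale0r. Qed.

Lemma cocycle0l n x y : x =1 (fun=> 0) -> cocycle n x y = 0.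
Proof.
move=> x0; apply: big1 => j _.
by rewrite comb0 // half0 triple0 x0 !mul0r !mulr0 !addr0.
Qed.

Lemma cocycle0r n x y : y =1 (fun=> 0) -> cocycle n x y = 0.
Proof.
move=> y0; apply: big1 => j _.
by rewrite (@comb0 j y) // tripleC triple0 y0 !(mul0r, mulr0) !addr0.
Qed.

Lemma combD n x y xy : (forall i, xy i = x i + y i) ->
  comb n xy = comb n x + comb n y.
Proof.
move=> Dxy; rewrite /comb -big_split; apply: eq_bigr => i _ /=.
by rewrite Dxy scalerDl.
Qed.

Lemma combS n x : comb n.+1 x = comb n x + x n *: b n.
Proof. exact: big_ord_recr. Qed.

Lemma cocycleS n x y : cocycle n.+1 x y = cocycle n x y +
  (x n * y n * quarter (b n) + y n * half (comb n x) (b n)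
   + x n * triple (comb n x) (comb n y) (b n)).
Proof. exact: big_ord_recr. Qed.

Variable L : {vspace 'rV['F_2]_N}.
Hypothesis L_even : doubly_even L.
Hypothesis Lb : forall i, b i \in L.

Lemma mem_comb n x : comb n x \in L.
Proof. by apply: memv_suml => i _; apply: memvZ. Qed.

Hint Resolve Lb mem_comb : core.

(** Each step reproduces P(u + b) = P(u) + P(b) + K(u,b); the trilinear term
    vanishes on equal arguments. *)
Lemma cocycle_diag n x : cocycle n x x = quarter (comb n x).
Proof.
elim: n => [|n IH]; first by rewrite /comb /cocycle !big_ord0 quarter0.
rewrite cocycleS combS IH (triple_diag L_even) //.
case: (F2P (x n)) => ->;
  rewrite ?scale0r ?scale1r ?addr0 ?(quarterD L_even) //; ring.
Qed.

Lemma cocycle_comm n x y :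
  cocycle n x y + cocycle n y x = half (comb n x) (comb n y).
Proof.
elim: n => [|n IH].
  by rewrite /comb /cocycle !big_ord0 half0 addr0.
rewrite !cocycleS !combS (tripleC (comb n y)).
(* Adding multiples of b to both arguments of K: the terms K(b,b) and T with a
   repeated argument vanish, which leaves what the correction terms produce. *)
have -> : half (comb n x + x n *: b n) (comb n y + y n *: b n) =
   half (comb n x) (comb n y) + y n * half (comb n x) (b n)
   + x n * half (comb n y) (b n)
   + (x n + y n) * triple (comb n x) (comb n y) (b n).
  have bab u v : u \in L -> v \in L -> triple v u v = 0.
    by move=> Lu Lv; rewrite tripleAC (triple_diag L_even).
  have bb u v : u \in L -> v \in L -> triple u v v = 0.
    by move=> Lu Lv; rewrite tripleC bab.
  case: (F2P (x n)) => ->; case: (F2P (y n)) => ->;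
    rewrite ?scale0r ?scale1r ?addr0 //.
  - ring.
  - rewrite (halfDr L_even) //; ring.
  - rewrite (halfDl L_even) // (halfC (b n)) (tripleAC _ (b n)); ring.
  - rewrite (halfDl L_even) ?memvD // !(halfDr L_even) // (half_diag L_even) //.
    rewrite tripleDr bb // bab // (halfC (b n)) (tripleAC _ (b n)); ring.
rewrite -IH -[RHS]addr0 -(addF2 (x n * y n * quarter (b n))); ring.
Qed.

(** The part y K(u,b) is linear in the second argument and quadratic in the
    first, so its defect is T(u,v,b) times the last coordinate; the part
    x T(u,v,b) supplies the two other terms of the expansion of T.  The sums of
    coordinates are passed as functions known pointwise, which avoids functional
    extensionality. *)
Lemma cocycle_assoc n x y z xy yz :
    (forall i, xy i = x i + y i) -> (forall i, yz i = y i + z i) ->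
  cocycle n x y + cocycle n xy z =
  cocycle n y z + cocycle n x yz + triple (comb n x) (comb n y) (comb n z).
Proof.
move=> Dxy Dyz; elim: n => [|n IH].
  by rewrite /comb /cocycle !big_ord0 triple0 !addr0.
have bab u v : u \in L -> v \in L -> triple v u v = 0.
  by move=> Lu Lv; rewrite tripleAC (triple_diag L_even).
have bb u v : u \in L -> v \in L -> triple u v v = 0.
  by move=> Lu Lv; rewrite tripleC bab.
rewrite !cocycleS (combD _ Dxy) (combD _ Dyz) !combS Dxy Dyz.
rewrite (halfDl L_even) // !tripleDl !tripleDm !tripleDr.
rewrite !tripleZl !tripleZm !tripleZr bb // bab // !(triple_diag L_even) //.
rewrite (tripleAC _ (b n)) (tripleC (b n)) (tripleAC _ (b n)).
rewrite addrACA IH; ring.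
Qed.

End Cocycle.

(** * Central extensions by the two-element group *)

Section TwistedLoop.

Local Open Scope group_scope.

(** Normalisation is bundled with the function because it makes (0, 0) a
    two-sided unit, so that the loop structure can be inferred. *)
Record cochain (V : finZmodType) := Cochain {
  cochain_fun :> V -> V -> 'F_2;
  cochain0l : forall y, cochain_fun 0%R y = 0%R;
  cochain0r : forall x, cochain_fun x 0%R = 0%R
}.

Definition twisted V (phi : cochain V) : Type := (V * 'F_2)%type.

Variables (V : finZmodType) (phi : cochain V).

HB.instance Definition _ := Finite.copy (twisted phi) (V * 'F_2)%type.

Implicit Types x y z : twisted phi.

Definition tw_mul x y : twisted phi :=
  (x.1 + y.1, x.2 + y.2 + phi x.1 y.1)%R.
Definition tw_one : twisted phi := (0, 0)%R.
Definition tw_ldiv x y : twisted phi :=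
  (y.1 - x.1, y.2 - x.2 - phi x.1 (y.1 - x.1))%R.
Definition tw_rdiv y x : twisted phi :=
  (y.1 - x.1, y.2 - x.2 - phi (y.1 - x.1) x.1)%R.

Lemma tw_mul1 : left_id tw_one tw_mul.
Proof. by case=> u a; rewrite /tw_mul /= cochain0l addr0 !add0r. Qed.

Lemma tw_mulr1 : right_id tw_one tw_mul.
Proof. by case=> u a; rewrite /tw_mul /= cochain0r !addr0. Qed.

HB.instance Definition _ := hasMul.Build (twisted phi) tw_mul.
HB.instance Definition _ :=
  Magma_isUMagma.Build (twisted phi) tw_mul1 tw_mulr1.

Lemma tw_mulE x y : x * y = (x.1 + y.1, x.2 + y.2 + phi x.1 y.1)%R.
Proof. by []. Qed.

Lemma tw_mulK x y : x * tw_ldiv x y = y.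
Proof.
case: x y => u a [v c]; rewrite tw_mulE /= [(u + _)%R]addrC subrK.
congr pair; ring.
Qed.

Lemma tw_ldivK x y : tw_ldiv x (x * y) = y.
Proof.
case: x y => u a [v c]; rewrite tw_mulE /tw_ldiv /= [(u + v)%R]addrC addrK.
congr pair; ring.
Qed.

Lemma tw_rdivK x y : tw_rdiv y x * x = y.
Proof.
case: x y => u a [v c]; rewrite tw_mulE /= subrK.
congr pair; ring.
Qed.

Lemma tw_mulrK x y : tw_rdiv (y * x) x = y.
Proof.
case: x y => u a [v c]; rewrite tw_mulE /tw_rdiv /= addrK.
congr pair; ring.
Qed.

HB.instance Definition _ := UMagma_isLoop.Build (twisted phi)
  tw_mulK tw_ldivK tw_rdivK tw_mulrK.

Lemma tw_commutator x y :
  loop_commutator x y = (0, phi x.1 y.1 - phi y.1 x.1)%R.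
Proof.
rewrite /loop_commutator !tw_mulE /ldiv /= /tw_ldiv /=.
rewrite [(y.1 + _)%R]addrC subrr cochain0r.
congr pair; ring.
Qed.

Lemma tw_associator x y z :
  loop_associator x y z =
  (0, phi x.1 y.1 + phi (x.1 + y.1) z.1
      - (phi y.1 z.1 + phi x.1 (y.1 + z.1)))%R.
Proof.
rewrite /loop_associator !tw_mulE /ldiv /= /tw_ldiv /= addrA subrr cochain0r.
congr pair; ring.
Qed.

Definition tw_ker : {set twisted phi} := [set x | x.1 == 0%R].

Lemma tw_kerP x : x \in tw_ker -> x = (0%R, x.2).
Proof. by rewrite inE; case: x => u a /= /eqP->. Qed.

Lemma tw_central : central tw_ker.
Proof.
move=> z x y /tw_kerP ->; rewrite !tw_mulE /= !cochain0l !cochain0r.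
rewrite !add0r !addr0; split; congr pair; ring.
Qed.

Lemma mem_tw_lcos x y : (y \in lcos tw_ker x) = (y.1 == x.1).
Proof.
apply/imsetP/eqP => [[z /tw_kerP -> ->]|E]; first by rewrite /= addr0.
by exists (ldiv x y); rewrite ?mulg_ldiv // inE /= E subrr.
Qed.

Lemma tw_rcos x : lcos tw_ker x = rcos tw_ker x.
Proof.
rewrite /lcos /rcos; apply: eq_in_imset => z Zz.
by have [/esym] := tw_central x x Zz.
Qed.

Lemma tw_lcosM x y :
  [set x * t | t in lcos tw_ker y] = lcos tw_ker (x * y).
Proof.
apply/setP=> t; rewrite mem_tw_lcos; apply/imsetP/eqP.
  by case=> s; rewrite mem_tw_lcos => /eqP Es ->; rewrite /= Es.
move=> E; exists (ldiv x t); rewrite ?mulg_ldiv // mem_tw_lcos /= E.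
by rewrite /= addrC addrA addNr add0r.
Qed.

Lemma tw_rcosM x y :
  [set t * y | t in rcos tw_ker x] = rcos tw_ker (x * y).
Proof.
rewrite -!tw_rcos; apply/setP=> t; rewrite mem_tw_lcos; apply/imsetP/eqP.
  by case=> s; rewrite mem_tw_lcos => /eqP Es ->; rewrite /= Es.
by move=> E; exists (rdiv t y); rewrite ?rdiv_mulg // mem_tw_lcos /= E /= addrK.
Qed.

Lemma tw_ker_normal : normal_subloop_axioms tw_ker.
Proof.
split=> [|x y|x y|x y|x|x y|x y].
- by rewrite inE.
- by rewrite !inE => /eqP /= -> /eqP ->; rewrite addr0.
- by rewrite !inE => /eqP /= -> /eqP ->; rewrite subrr.
- by rewrite !inE => /eqP /= -> /eqP ->; rewrite subrr.
- exact: tw_rcos.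
- exact: tw_lcosM.
- exact: tw_rcosM.
Qed.

Definition tw_normal := NormalSubloop tw_ker_normal.

Definition tw_base (A : factor tw_normal) : V := (rep A).1.

Lemma tw_base_proj x : tw_base (fproj tw_normal x) = x.1.
Proof.
apply/eqP; rewrite eq_sym -mem_tw_lcos.
by apply/(lcosP tw_normal); rewrite lcos_rep.
Qed.

Lemma tw_base_bij : bijective tw_base.
Proof.
exists (fun u : V => fproj tw_normal ((u, 0%R) : twisted phi)) => [A|u];
  last exact: tw_base_proj.
rewrite -[RHS]repK; apply/fprojE/(lcosP tw_normal).
by rewrite mem_tw_lcos.
Qed.

Lemma tw_baseM : {morph tw_base : A B / A * B >-> (A + B)%R}.
Proof.
by move=> A B; rewrite -(repK A) -(repK B) -fprojM !tw_base_proj.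
Qed.

Lemma tw_card_center : #|tw_ker| = 2.
Proof.
have -> : tw_ker = [set ((0%R, a) : twisted phi) | a in [set: 'F_2]].
  apply/setP=> x; apply/idP/imsetP => [/tw_kerP E|[a _ ->]].
    by exists x.2.
  by rewrite inE.
by rewrite card_imset ?cardsT ?card_Fp // => a b [].
Qed.

Lemma tw_ker_gen (m : twisted phi) :
  m \in tw_ker -> m != 1 -> m = (0, 1)%R.
Proof.
move=> /tw_kerP -> ; case: (F2P m.2) => -> //.
by rewrite eqxx.
Qed.

Lemma tw_ker_exp n : ((0, 1)%R : twisted phi) ^+ n = (0, n%:R)%R.
Proof.
elim: n => [|n IH]; first by [].
by rewrite expgS IH tw_mulE /= addr0 cochain0l addr0 nat1r.
Qed.

End TwistedLoop.

(** * The Moufang identities *)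

Section TwistedMoufang.

Variables (V : finZmodType) (phi : cochain V) (t : V -> V -> V -> 'F_2).
Hypothesis phi_assoc : forall u v w,
  phi u v + phi (u + v) w = phi v w + phi u (v + w) + t u v w.
Hypothesis tDl : forall u v w z, t (u + v) w z = t u w z + t v w z.
Hypothesis tC : forall u v w, t u v w = t v u w.
Hypothesis tAC : forall u v w, t u v w = t u w v.
Hypothesis t_diag : forall u v, t u u v = 0.

(** With t standing for the associativity defect, the two sides of a Moufang
    identity differ by rebracketings, whose defects cancel in pairs once the
    terms of t with a repeated argument are seen to vanish. *)
Lemma tw_moufang : moufang (twisted phi).
Proof.
have tDr u v w w' : t u v (w + w') = t u v w + t u v w'.
  by rewrite tAC tC tDl !(tC _ u) !(tAC u _ v).
have t_diag2 u v : t u v u = 0 by rewrite tAC t_diag.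
have t_diag3 u v : t v u u = 0 by rewrite tC t_diag2.
(* Read as a rewriting rule for phi, one use of the defect formula is one
   rebracketing. *)
have A u v w : phi u v = phi v w + phi u (v + w) + t u v w - phi (u + v) w.
  exact: canRL (addrK _) (phi_assoc u v w).
move=> [x a] [y b] [z c].
split; rewrite !tw_mulE /=; congr pair; rewrite ?addrA //.
- rewrite (A x y (x + z)) (A (x + y) x z) tDr tDl t_diag t_diag2 (tC y x).
  rewrite !(addr0, add0r) -[LHS]addr0 -(addF2 (t x y z)) !addrA; ring.
- rewrite (A (y + x) z x) (A y x (z + x)) tDr tDl t_diag2 t_diag3 (tAC y z).
  rewrite !(addr0, add0r) -[LHS]addr0 -(addF2 (t y x z)) !addrA; ring.
- rewrite (A x y (z + x)) (A y z x) tDr t_diag2 (tAC y z) (tC y x) !addrA; ring.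
- rewrite (A x y (z + x)) (A y z x) (A x (y + z) x) tDr !t_diag2.
  rewrite (tAC y z) (tC y x) !addrA; ring.
Qed.

End TwistedMoufang.

(** * The code loop *)

Section CodeLoop.

Variables (N : nat) (L : {vspace 'rV['F_2]_N}).

HB.instance Definition _ := [Countable of subvs_of L by <:].
HB.instance Definition _ := [Finite of subvs_of L by <:].

Implicit Types u v w : subvs_of L.

(** Extended by zero beyond the dimension of the code, so as to be a coordinate
    function in the sense of [comb]. *)
Definition code_coord u (i : nat) : 'F_2 :=
  oapp (fun j => coord (vbasis L) j (vsval u)) 0 (insub i).

Definition code_cocycle u v : 'F_2 :=
  cocycle (nth 0 (vbasis L)) (\dim L) (code_coord u) (code_coord v).

Lemma code_coordD u v i : code_coord (u + v) i = code_coord u i + code_coord v i.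
Proof.
rewrite /code_coord; case: insub => [j|] /=; last by rewrite addr0.
by rewrite linearD.
Qed.

Lemma code_coord0 : code_coord 0 =1 (fun=> 0).
Proof.
by move=> i; rewrite /code_coord; case: insub => //= j; rewrite linear0.
Qed.

Lemma comb_code_coord u :
  comb (nth 0 (vbasis L)) (\dim L) (code_coord u) = vsval u.
Proof.
rewrite [RHS](coord_vbasis (subvsP u)); apply: eq_bigr => i _.
by rewrite /code_coord valK.
Qed.

Definition code_cochain : cochain (subvs_of L) :=
  @Cochain _ code_cocycle
    (fun v => cocycle0l _ _ _ code_coord0) (fun u => cocycle0r _ _ _ code_coord0).

Lemma mem_vbasis_nth i : nth 0 (vbasis L) i \in L.
Proof.
case: (ltnP i (size (vbasis L))) => [lti|gei]; last by rewrite nth_default ?mem0v.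
by rewrite vbasis_mem ?mem_nth.
Qed.

Hypothesis L_even : doubly_even L.

Local Notation phi := code_cochain.

Lemma code_cocycle_diag u : phi u u = quarter (vsval u).
Proof.
by rewrite -(comb_code_coord u); apply: (cocycle_diag L_even mem_vbasis_nth).
Qed.

Lemma code_cocycle_comm u v : phi u v - phi v u = half (vsval u) (vsval v).
Proof.
rewrite oppF2 -(comb_code_coord u) -(comb_code_coord v).
exact: (cocycle_comm L_even mem_vbasis_nth).
Qed.

Lemma code_cocycle_assoc u v w :
  phi u v + phi (u + v) w =
  phi v w + phi u (v + w) + triple (vsval u) (vsval v) (vsval w).
Proof.
rewrite -(comb_code_coord u) -(comb_code_coord v) -(comb_code_coord w).
by apply: (cocycle_assoc L_even mem_vbasis_nth); apply: code_coordD.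
Qed.

Lemma code_loop_exists :
  @code_loop N L (twisted phi) (tw_normal phi) (@tw_base _ phi).
Proof.
split.
- apply: (@tw_moufang _ phi (fun u v w => triple (vsval u) (vsval v) (vsval w))).
  + exact: code_cocycle_assoc.
  + by move=> u v w z; rewrite /= tripleDl.
  + by move=> u v w; rewrite tripleC.
  + by move=> u v w; rewrite tripleAC.
  + by move=> u v; apply: (triple_diag L_even); apply: subvsP.
- exact: tw_central.
- exact: tw_card_center.
- exact: tw_base_bij.
- exact: tw_baseM.
- move=> m x Zm /(tw_ker_gen Zm) -> /=.
  rewrite tw_base_proj tw_ker_exp tw_mulE code_cocycle_diag.
  by rewrite addF2_lmod addF2 add0r.
- move=> m x y Zm /(tw_ker_gen Zm) -> /=.
  by rewrite !tw_base_proj tw_ker_exp tw_commutator code_cocycle_comm.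
- move=> m x y z Zm /(tw_ker_gen Zm) -> /=.
  rewrite !tw_base_proj tw_ker_exp tw_associator code_cocycle_assoc.
  by rewrite addrAC subrr add0r.
Qed.

Lemma code_loop_exact :
  short_exact (tw_normal phi)
    (fun x : twisted phi => tw_base (fproj (tw_normal phi) x)).
Proof.
split=> [x y|u|x]; first by rewrite !tw_base_proj.
- by exists (u, 0); rewrite tw_base_proj.
- by rewrite tw_base_proj inE; split=> /eqP.
Qed.

End CodeLoop.

Lemma quotient_by_factor N (V : finType) (A : adinkra N V)
    (L : {vspace 'rV['F_2]_N}) (T : finLoopType) (Z : normalSubloop T)
    (f : factor Z -> subvs_of L) :
    bijective f -> is_cube_quotient A (@code_translation N L) ->
  is_cube_quotient A (factor_translation f).
Proof.
case=> g fK gK [C [p [Ccube Cinv Chom psurj pedge pfib]]].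
exists C, p; split=> // [q|x y]; first exact: Cinv.
rewrite pfib; split=> [[u ->]|[q ->]]; last by exists (f q).
by exists (g u); rewrite /factor_translation gK.
Qed.

Theorem theorem6p1p1 (N : nat) (V : finType) (A : adinkra N V) :
  (adinkra_connected A ->
     exists L : {vspace 'rV['F_2]_N},
       doubly_even L /\ is_cube_quotient A (@code_translation N L))
  /\
  (forall L : {vspace 'rV['F_2]_N},
     doubly_even L -> is_cube_quotient A (@code_translation N L) ->
     exists (T : finLoopType) (Z : normalSubloop T)
            (f : factor Z -> subvs_of L),
       [/\ code_loop f,
           short_exact Z (fun x : T => f (fproj Z x))
         & is_cube_quotient A (factor_translation f)]).
Proof.
split=> [[/card_gt0P[v0 _] con]|L L_even quoA].
  exists (stabiliser A v0); split; first exact: stabiliser_doubly_even.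
  exact: stabiliser_quotient.
exists (twisted (code_cochain L)), (tw_normal (code_cochain L)), (@tw_base _ _).
split; first exact: code_loop_exists.
  exact: code_loop_exact.
by apply: quotient_by_factor quoA; apply: tw_base_bij.
Qed.
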